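(* Let $\varphi$ be a norm on $\mathbb{R}^2$ whose unit ball $\{\varphi\le1\}$ is strictly convex (i.e. has no boundary facet). Let $\mathrm{U}\subseteq\mathbb{R}^2$ be a bounded, open, Pareto efficient set and $f:\mathrm{U}\to(0,\infty)$ bounded and continuous. For $n\in\mathbb{N}$ let $X_{nf}$ be a Poisson point process in $\mathrm{U}$ of intensity $nf$, let $u_n=u_{X_{nf}}$ be the height function of Pareto hull peeling of $X_{nf}$, and let $\bar u_n=n^{-1/2}u_n$. Then, with probability one, $\bar u_n\to\infty$ locally uniformly in $\mathrm{U}$.
   Context: For compact $A\subseteq\mathbb{R}^2$ the Pareto hull is $\mathcal{P}(A)=\{x\in\mathbb{R}^2:\forall y\neq x\ \exists a\in A\text{ with }\varphi(a-x)<\varphi(a-y)\}$, and $\mathcal{P}(\emptyset)=\emptyset$. For finite $A$, Pareto hull peeling is $E_1(A)=\mathcal{P}(A)$, $E_{k+1}(A)=\mathcal{P}(A\cap \mathrm{int}(E_k(A)))$, and the height function is $u_A=\sum_{k\ge1}1_{\mathrm{int}(E_k(A))}$ on $\mathbb{R}^2$. A bounded open set $\mathrm{U}$ is Pareto efficient if $\mathrm{int}(\mathcal{P}(\bar{\mathrm{U}}))=\mathrm{U}$. Convergence to $\infty$ locally uniformly means $\inf_K\bar u_n\to\infty$ for each compact $K\subseteq\mathrm{U}$. All the processes $X_{nf}$ are defined on a common probability space. *)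

(* Defs.v *)
From HB Require Import structures.
From mathcomp Require Import all_boot all_order all_algebra.
From mathcomp Require Import all_classical all_reals all_analysis.
From mathcomp Require Import measurable_realfun.

Set Implicit Arguments.
Unset Strict Implicit.
Unset Printing Implicit Defensive.

Import Order.TTheory GRing.Theory Num.Theory.
Import numFieldNormedType.Exports.

Local Open Scope classical_set_scope.
Local Open Scope ring_scope.

Definition is_norm (R : realType) (phi : R * R -> R) : Prop :=
  [/\ forall x y, phi (x + y) <= phi x + phi y,
      forall (c : R) x, phi (c *: x) = `|c| * phi x &
      forall x, phi x = 0 -> x = 0].

Definition strictly_convex_set (R : realType) (C : set (R * R)) : Prop :=
  forall x y (t : R), C x -> C y -> x <> y -> 0 < t < 1 ->
    C° (t *: x + (1 - t) *: y).

(* Since no [a] lies in [set0], the formula gives [pareto_hull phi set0 = set0]. *)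
Definition pareto_hull (R : realType) (phi : R * R -> R) (A : set (R * R)) :
    set (R * R) :=
  [set x | forall y, y <> x -> exists2 a, A a & phi (a - x) < phi (a - y)].

(* Indices are shifted by one: [pareto_peel phi A k] is E_{k+1}(A). *)
Fixpoint pareto_peel (R : realType) (phi : R * R -> R) (A : set (R * R))
    (k : nat) : set (R * R) :=
  if k is k'.+1 then pareto_hull phi (A `&` (pareto_peel phi A k')°)
  else pareto_hull phi A.

Definition pareto_height (R : realType) (phi : R * R -> R) (A : set (R * R))
    (x : R * R) : \bar R :=
  (\sum_(0 <= k <oo) (\1_((pareto_peel phi A k)°) x)%:E)%E.

Definition pareto_efficient (R : realType) (phi : R * R -> R)
    (U : set (R * R)) : Prop :=
  (pareto_hull phi (closure U))° = U.

Definition npoints (R : realType) (Omega : Type) (X : Omega -> set (R * R))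
    (B : set (R * R)) (w : Omega) : \bar R :=
  counting (X w `&` B).

(* Poisson process on [U] with intensity [g] with respect to Lebesgue measure,
   for [g] nonnegative and integrable on [U].  As its intensity is diffuse, such
   a process is almost surely simple, so it is encoded as a random set of
   points.  [poisson_prob] ignores its nat argument; unlike [poisson_pmf], it is
   the point mass at 0 when the rate vanishes. *)
Definition is_poisson_process (R : realType) (d : measure_display)
    (Omega : measurableType d) (P : probability Omega R)
    (U : set (R * R)) (g : R * R -> R) (X : Omega -> set (R * R)) : Prop :=
  [/\ forall w, X w `<=` U,
      forall B, measurable B -> B `<=` U ->
        measurable_fun setT (npoints X B),
      forall B, measurable B -> B `<=` U -> forall k : nat,
        P [set w | npoints X B w = k%:R%:E] =
        poisson_prob
          (fine (\int[lebesgue_measure \x lebesgue_measure]_(x in B)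
                   (g x)%:E)%E)
          0%N [set k] &
      forall (m : nat) (B : 'I_m -> set (R * R)) (C : 'I_m -> set (\bar R)),
        (forall i, measurable (B i) /\ B i `<=` U) ->
        trivIset setT B ->
        (forall i, measurable (C i)) ->
        P (\bigcap_i (npoints X (B i) @^-1` C i)) =
        (\prod_i P (npoints X (B i) @^-1` C i))%E].

(* Main.v *)
Require Import Defs.
From mathcomp Require Import all_boot all_order all_algebra.
From mathcomp Require Import all_classical all_reals all_analysis.
From mathcomp Require Import measurable_realfun.
From mathcomp Require Import ring lra.

Set Implicit Arguments.
Unset Strict Implicit.
Unset Printing Implicit Defensive.

Import Order.TTheory GRing.Theory Num.Theory.
Import numFieldNormedType.Exports.

Local Open Scope classical_set_scope.
Local Open Scope ring_scope.

(* A norm with strictly convex ball decreases strictly along a line towards its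
   minimum, so for [y <> x] some closed half-plane with [x] on its boundary
   consists of points closer to [x] than to [y].  Hence [x] lies in the Pareto
   hull of any set that meets every closed half-plane through [x].

   A cap of height of order [l^2] of a disc contains a cell of length [l] and
   width [l^2] hugging the circle.  If all such cells of an annulus of width of
   order [l^2] are hit, one peeling step removes at most that annulus, which
   gives order [l^-2] layers around the centre.  With [l = dl * n^(-1/4)] this
   is a multiple of [sqrt n], as large as desired for small [dl], while a cell,
   of area [l^3], is void with probability at most
   [exp (- c * dl^3 * n^(1/4))].  A union bound over the polynomially many
   cells and Borel-Cantelli conclude on each disc; rational discs and
   compactness do the rest. *)

(** * Half-planes of points closer to one point than to another *)

Section norm_halfplanes.
Variables (R : realType) (phi : R * R -> R).
Implicit Types (x y z u v : R * R) (c t s : R).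
Hypotheses (phi_norm : is_norm phi)
  (phi_strict : strictly_convex_set [set x | phi x <= 1]).

Let phiD x y : phi (x + y) <= phi x + phi y. Proof. by case: phi_norm. Qed.

Let phiZ c x : phi (c *: x) = `|c| * phi x. Proof. by case: phi_norm. Qed.

Let phi_eq0 x : phi x = 0 -> x = 0. Proof. by case: phi_norm => _ _; apply. Qed.

Let phi0 : phi 0 = 0. Proof. by rewrite -(scale0r 0) phiZ normr0 mul0r. Qed.

Let phiN x : phi (- x) = phi x.
Proof. by rewrite -scaleN1r phiZ normrN1 mul1r. Qed.

Let phi_ge0 x : 0 <= phi x.
Proof. by have := phiD x (- x); rewrite subrr phi0 phiN; lra. Qed.

Let phi_gt0 x : x <> 0 -> 0 < phi x.
Proof.
by move=> x0; rewrite lt0r phi_ge0 andbT; apply/eqP => /phi_eq0.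
Qed.

Let phi_convex t x y : 0 <= t <= 1 ->
  phi (t *: x + (1 - t) *: y) <= t * phi x + (1 - t) * phi y.
Proof.
move=> /andP[t0 t1]; apply: le_trans (phiD _ _) _.
by rewrite !phiZ !ger0_norm ?subr_ge0.
Qed.

(** An interior point of the unit ball can be stretched by some factor [1 + e] with [e > 0] without
    leaving the ball. *)
Lemma norm_interior_lt1 z : [set x | phi x <= 1]° z -> phi z < 1.
Proof.
move=> z1; have [e [e0 /= le1]] : exists e, 0 < e /\ phi ((1 + e) *: z) <= 1.
  have : (1 + e) *: z @[e --> 0] --> (1 + 0) *: z.
    by apply: cvgZr_tmp; apply: cvgD; [exact: cvg_cst|exact: cvg_id].
  rewrite addr0 scale1r => /(_ _ z1) /= /nbhs_ballP[e /= e0 he].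
  exists (e / 2); split; first by rewrite divr_gt0.
  apply: he; rewrite /ball/= sub0r normrN gtr0_norm; lra.
rewrite phiZ gtr0_norm in le1; last by lra.
have := phi_ge0 z; nra.
Qed.

(** After rescaling to the unit sphere, strict convexity puts the midpoint in the interior of the
    ball. *)
Lemma norm_midpoint_lt x y : x <> y -> phi x = phi y ->
  phi (2^-1 *: x + 2^-1 *: y) < phi x.
Proof.
move=> xy pxy; have x0 : 0 < phi x.
  apply: phi_gt0 => x0; apply: xy; rewrite x0.
  by apply/esym/phi_eq0; rewrite -pxy x0 phi0.
set m := phi x in x0 *.
have e1 : phi (m^-1 *: x) = 1.
  by rewrite phiZ gtr0_norm ?invr_gt0// mulVf// gt_eqF.
have e2 : phi (m^-1 *: y) = 1.
  by rewrite phiZ gtr0_norm ?invr_gt0// -pxy mulVf// gt_eqF.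
have := @phi_strict (m^-1 *: x) (m^-1 *: y) 2^-1.
rewrite /= e1 e2 => /(_ (lexx _) (lexx _)).
have -> : (1 - 2^-1 : R) = 2^-1 by lra.
move=> /(_ _ _)/norm_interior_lt1; rewrite !scalerA.
rewrite ![2^-1 * _]mulrC -!scalerA -scalerDr phiZ gtr0_norm ?invr_gt0//.
rewrite mulrC ltr_pdivrMr// mul1r; apply; last by lra.
move=> /(congr1 (fun z => m *: z)); rewrite !scalerA divff ?gt_eqF//.
by rewrite !scale1r.
Qed.

(* The minimizer makes [e - t0 *: v] Birkhoff orthogonal to [v]. *)
Lemma norm_min_line (e : R * R) v : v <> 0 ->
  exists t0, forall t, phi (e - t0 *: v) <= phi (e - t *: v).
Proof.
move=> v0; have pv := phi_gt0 v0.
have h s t : phi (e - s *: v) - phi (e - t *: v) <= `|s - t| * phi v.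
  have := phiD ((t - s) *: v) (e - t *: v).
  have -> : (t - s) *: v + (e - t *: v) = e - s *: v.
    by rewrite scalerBl addrC addrA subrK.
  by rewrite phiZ distrC; lra.
have lip s t : `|phi (e - s *: v) - phi (e - t *: v)| <= `|s - t| * phi v.
  by have := h s t; have := h t s; rewrite (distrC t) ler_norml; lra.
have cont : continuous (fun t : R => phi (e - t *: v) : R).
  move=> t; apply/(@cvgrPdist_lt _ R^o) => d d0.
  exists (d / phi v) => [|s /= ts]; first exact: divr_gt0.
  by apply: le_lt_trans (lip t s) _; rewrite -ltr_pdivlMr.
have b0 : 0 <= 2 * phi e / phi v by rewrite divr_ge0// mulr_ge0.
(* Outside this interval [phi (t *: v) > 2 * phi e], so the value at [t] exceeds [phi e], the value
   at 0: the minimum on the interval is global. *)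
have [t0 /= _ ht0] := @EVT_min R _ (- (2 * phi e / phi v)) (2 * phi e / phi v)
  (snd (ge0_cp b0)) (continuous_subspaceT cont).
exists t0 => t; have [tin|] := boolP
  (t \in `[- (2 * phi e / phi v), 2 * phi e / phi v]).
  exact: ht0.
rewrite in_itv/= -ler_norml -ltNge ltr_pdivrMr// => ht.
have := ht0 0; rewrite in_itv/= oppr_le0 b0 => /(_ isT); rewrite scale0r subr0.
have := phiD (- (e - t *: v)) e.
rewrite opprB subrK phiZ -[t *: v - e]opprB phiN.
lra.
Qed.

(** The convex function [t |-> phi (s *: u + t *: v)] is minimal at 0. If it failed to decrease
    strictly between [t - c] and [t], convexity would make its value at [t - c] equal to the
    minimum, and by strict convexity the midpoint of the two minimizers would lie below it. *)
Lemma norm_decreasing u v s t c : v <> 0 ->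
  (forall t, phi u <= phi (u + t *: v)) -> t <= 0 -> 0 < c ->
  phi (s *: u + t *: v) < phi (s *: u + (t - c) *: v).
Proof.
move=> v0 umin t0 c0; have [->|s0] := eqVneq s 0.
  rewrite !scale0r !add0r !phiZ ltr_pM2r ?phi_gt0// !ler0_norm//; lra.
have smin r : phi (s *: u) <= phi (s *: u + r *: v).
  have -> : s *: u + r *: v = s *: (u + (r / s) *: v).
    by rewrite scalerDr scalerA mulrC divfK.
  by rewrite !phiZ ler_wpM2l.
rewrite ltNge; apply/negP => gle.
have tc : t - c < 0 by lra.
(* The weight that writes [t] as a convex combination of [t - c] and 0. *)
pose a := t / (t - c).
have a0 : 0 <= a by rewrite /a ler_ndivlMr ?mul0r.
have a1 : a < 1 by rewrite /a ltr_ndivrMr// mul1r; lra.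
have := @phi_convex a (s *: u + (t - c) *: v) (s *: u).
rewrite a0 (ltW a1) => /(_ isT).
have -> : a *: (s *: u + (t - c) *: v) + (1 - a) *: (s *: u) = s *: u + t *: v.
  rewrite scalerDr addrAC -scalerDl [a + _]addrC subrK scale1r scalerA.
  by rewrite /a divfK// lt_eqF.
move=> gcv; have := smin (t - c) => ge.
have eqm : phi (s *: u) = phi (s *: u + (t - c) *: v).
  by apply/eqP; rewrite eq_le ge /=; nra.
have ne : s *: u <> s *: u + (t - c) *: v.
  move=> /(congr1 (fun z => z - s *: u)); rewrite subrr addrAC subrr add0r.
  by move=> /esym/eqP; rewrite scaler_eq0 lt_eqF//= => /eqP.
have := norm_midpoint_lt ne eqm.
rewrite scalerDr addrA -scalerDl.
have -> : 2^-1 + 2^-1 = 1 :> R by lra.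
by rewrite scale1r scalerA ltNge smin.
Qed.

(** Take [v = y - x] and [u] Birkhoff orthogonal to [v]. Writing [a - x] as [s *: u + t *: v] turns
    [a - y] into [s *: u + (t - 1) *: v], so [norm_decreasing] applies on the half-plane [t <= 0],
    whose boundary passes through [x] parallel to [u]. *)
Lemma norm_lt_halfplane x y : y <> x ->
  exists p, exists2 q, p ^+ 2 + q ^+ 2 = 1 &
    forall a : R * R, 0 <= p * (a.1 - x.1) + q * (a.2 - x.2) ->
      phi (a - x) < phi (a - y).
Proof.
move=> yx; pose v : R * R := y - x; pose e : R * R := (- v.2, v.1).
have v0 : v <> 0 by move=> /subr0_eq.
have [t0 ht0] := norm_min_line e v0.
pose u : R * R := e - t0 *: v.
have umin t : phi u <= phi (u + t *: v).
  by have := ht0 (t0 - t); rewrite scalerBl opprB addrCA addrC.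
have n0 : 0 < v.1 ^+ 2 + v.2 ^+ 2.
  rewrite lt0r paddr_eq0 ?sqr_ge0// !sqrf_eq0 addr_ge0 ?sqr_ge0// andbT.
  apply: contra_notN v0 => /andP[/eqP v1 /eqP v2].
  by rewrite [LHS]surjective_pairing v1 v2.
(* The determinant of [u] and [v] equals that of [e] and [v]. As [e] is [v] turned by a quarter, it
   is nonzero, and Cramer's rule below yields the coordinates [s] and [t]. *)
have uE : (u.1 * v.2 - u.2 * v.1) = - (v.1 ^+ 2 + v.2 ^+ 2).
  by rewrite /u /= /GRing.scale/=; ring.
have u0 : 0 < u.1 ^+ 2 + u.2 ^+ 2.
  rewrite lt0r paddr_eq0 ?sqr_ge0// !sqrf_eq0 addr_ge0 ?sqr_ge0// andbT.
  apply/negP => /andP[/eqP u1 /eqP u2]; move: uE; rewrite u1 u2; lra.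
pose m := Num.sqrt (u.1 ^+ 2 + u.2 ^+ 2).
have m0 : 0 < m by rewrite sqrtr_gt0.
have m2 : m ^+ 2 = u.1 ^+ 2 + u.2 ^+ 2 by rewrite sqr_sqrtr// ltW.
exists (- u.2 / m), (u.1 / m).
  by rewrite !expr_div_n sqrrN -mulrDl addrC m2 divff// gt_eqF.
move=> a; rewrite mulrAC [_ / m * _]mulrAC -mulrDl pmulr_lge0 ?invr_gt0// => ha.
pose w := v.1 ^+ 2 + v.2 ^+ 2.
pose b := a - x.
pose s := - (b.1 * v.2 - b.2 * v.1) / w.
pose t := - (u.1 * b.2 - u.2 * b.1) / w.
have w0 : w != 0 by rewrite gt_eqF.
have cramer (x1 y1 : R) : x1 * (u.1 * v.2 - u.2 * v.1) = y1 -> x1 = - y1 / w.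
  by move=> <-; rewrite uE mulrN opprK mulfK.
have bE : b = s *: u + t *: v.
  rewrite [LHS]surjective_pairing [RHS]surjective_pairing; congr pair.
    change (b.1 = s * u.1 + t * v.1); rewrite {1}(cramer b.1 _ erefl) /s /t.
    by field.
  change (b.2 = s * u.2 + t * v.2); rewrite {1}(cramer b.2 _ erefl) /s /t.
  by field.
have -> : a - y = s *: u + (t - 1) *: v.
  by rewrite scalerBl scale1r addrA -bE /v /b opprB addrA subrK.
rewrite -/b bE; apply: norm_decreasing => //.
by rewrite /t mulNr oppr_le0 divr_ge0 ?(ltW n0)//; move: ha; rewrite /b/=; lra.
Qed.

End norm_halfplanes.

(** * Cells along a circle *)

Section arcs.
Variable R : realType.
Implicit Types (r l p q x y rho : R) (z a : R * R).

(** The point of the circle above [x] is within about [l] of the tangency point [(r * p, r * q)] in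
    each coordinate, so its projection on [(p, q)] falls short of [r] only by a quadratic amount, at
    most [10 / rho * l ^+ 2]. Descending to [y] costs at most a further [l ^+ 2]. *)
Lemma arc_near_tangent rho r l p q x y : 0 < rho -> rho / 2 <= r ->
  0 < l -> l <= 1 -> l <= r / 16 -> p ^+ 2 + q ^+ 2 = 1 -> `|p| <= q ->
  `|x - r * p| <= l ->
  Num.sqrt (r ^+ 2 - x ^+ 2) - l ^+ 2 <= y < Num.sqrt (r ^+ 2 - x ^+ 2) ->
  x ^+ 2 + y ^+ 2 < r ^+ 2 /\ r - (1 + 10 / rho) * l ^+ 2 <= p * x + q * y.
Proof.
move=> rho0 rrho l0 l1 lr pq1 pq xl.
have r0 : 0 < r by lra.
have q0 : 0 <= q by apply: le_trans pq.
have p2q : p ^+ 2 <= q ^+ 2 by rewrite -[p ^+ 2]real_normK ?num_real// lerXn2r.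
have q2 : 1 / 2 <= q by rewrite -[_ <= _](@ler_pXn2r _ 2) ?nnegrE//; lra.
have q1 : q <= 1.
  by rewrite -[_ <= _](@ler_pXn2r _ 2) ?nnegrE//; have := sqr_ge0 p; lra.
have d2 : (x - r * p) ^+ 2 <= l ^+ 2.
  by rewrite -[X in X <= _]real_normK ?num_real// lerXn2r ?nnegrE// ltW.
have rp : `|r * p| <= r by rewrite normrM (gtr0_norm r0) ger_pMr//; lra.
have rp2 : (r * p) ^+ 2 <= r ^+ 2 / 2.
  rewrite exprMn; have : 0 <= r ^+ 2 by rewrite sqr_ge0.
  nra.
(* This keeps the arc away from the horizontal diameter: its height is at least [r / 2], so [y] is
   nonnegative even after the descent by [l ^+ 2]. *)
have x2 : x ^+ 2 <= 3 / 4 * r ^+ 2.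
  have -> : x = r * p + (x - r * p) by lra.
  move: rp xl; rewrite !ler_norml; set t := r * p; set d := x - _.
  move=> /andP[? ?] /andP[? ?].
  have td : t * d <= r * l.
    apply: le_trans (ler_norm _) _.
    by rewrite normrM ler_pM// ler_norml; apply/andP.
  have -> : (t + d) ^+ 2 = t ^+ 2 + 2 * (t * d) + d ^+ 2 by ring.
  have : r * l <= r * (r / 16) by rewrite ler_pM2l.
  have : l ^+ 2 <= (r / 16) ^+ 2 by rewrite lerXn2r ?nnegrE//; lra.
  move: rp2 d2; rewrite -/t -/d; have := sqr_ge0 r; lra.
set s := Num.sqrt _ => /andP[sy ys].
have s2 : s ^+ 2 = r ^+ 2 - x ^+ 2.
  by rewrite /s sqr_sqrtr//; have := sqr_ge0 r; lra.
have s0 : 0 <= s by rewrite sqrtr_ge0.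
have sr : r / 2 <= s.
  rewrite -[_ <= _](@ler_pXn2r _ 2) ?nnegrE//; last by lra.
  by rewrite s2; lra.
have ll : l ^+ 2 <= l by rewrite expr2 ger_pMr.
have y0 : 0 <= y by lra.
split.
  by have : y ^+ 2 < s ^+ 2; [rewrite ltrXn2r|rewrite s2; lra].
(* Both points lie on the circle, so the difference of the squared ordinates is that of the squared
   abscissas; factor both and divide by [s + r * q >= r]. *)
have sq : (s - r * q) ^+ 2 <= 9 * l ^+ 2.
  have e : (s - r * q) * (s + r * q) = (r * p - x) * (r * p + x).
    transitivity (s ^+ 2 - r ^+ 2 * q ^+ 2); first by ring.
    have -> : q ^+ 2 = 1 - p ^+ 2 by lra.
    by rewrite s2; ring.
  have srq : r <= s + r * q.
    by have : r * (1 / 2) <= r * q; [rewrite ler_pM2l|lra].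
  have h1 : `|s - r * q| * r <= l * (2 * r + l).
    apply: (@le_trans _ _ (`|s - r * q| * `|s + r * q|)).
      by rewrite ler_wpM2l// (le_trans srq)// ler_norm.
    rewrite -normrM e normrM distrC ler_pM//.
    move: rp xl; rewrite !ler_norml => /andP[? ?] /andP[? ?].
    by apply/andP; split; lra.
  have h2 : `|s - r * q| <= 2 * l + l * (1 / 16).
    rewrite -(ler_pM2r r0); apply: (le_trans h1).
    have : l * l <= l * (r / 16) by rewrite ler_pM2l.
    lra.
  have -> : 9 * l ^+ 2 = (3 * l) ^+ 2 by ring.
  by rewrite -[X in X <= _]real_normK ?num_real// lerXn2r ?nnegrE//; lra.
(* Polarization: the inner product of two points of the circle in terms of their squared distance,
   which is at most [(1 + 9) * l ^+ 2]. *)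
have e : 2 * r * (p * x + q * s) =
    2 * r ^+ 2 - ((x - r * p) ^+ 2 + (s - r * q) ^+ 2).
  have -> : 2 * r ^+ 2 = (x ^+ 2 + s ^+ 2) + r ^+ 2 * (p ^+ 2 + q ^+ 2).
    by rewrite s2 pq1; ring.
  by ring.
have pxqs : r - 10 / rho * l ^+ 2 <= p * x + q * s.
  have r20 : 0 < 2 * r by lra.
  rewrite -(ler_pM2l r20) e mulrBr.
  have rr : 1 <= 2 * r / rho by rewrite ler_pdivlMr//; lra.
  have : 1 * (10 * l ^+ 2) <= (2 * r / rho) * (10 * l ^+ 2).
    by rewrite ler_wpM2r// mulr_ge0 ?sqr_ge0.
  have -> : 2 * r / rho * (10 * l ^+ 2) = 2 * r * (10 / rho * l ^+ 2) by ring.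
  have -> : 2 * r * r = 2 * r ^+ 2 by ring.
  by lra.
have : q * (s - l ^+ 2) <= q * y by rewrite ler_wpM2l.
have : q * l ^+ 2 <= l ^+ 2 by rewrite ger_pMl// exprn_gt0.
by rewrite mulrBr mulrDl mul1r; lra.
Qed.

(** The Euclidean disc, written out because the library's balls of [R * R] are squares. *)
Definition disc z r :=
  [set a : R * R | (a.1 - z.1) ^+ 2 + (a.2 - z.2) ^+ 2 < r ^+ 2].

Lemma open_disc z r : open (disc z r).
Proof.
have c : continuous (fun a : R * R => (a.1 - z.1) ^+ 2 + (a.2 - z.2) ^+ 2 : R).
  move=> b.
  have c1 : (a.1 - z.1 : R) @[a --> b] --> (b.1 - z.1 : R).
    by apply: cvgB; [exact: cvg_fst|exact: cvg_cst].
  have c2 : (a.2 - z.2 : R) @[a --> b] --> (b.2 - z.2 : R).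
    by apply: cvgB; [exact: cvg_snd|exact: cvg_cst].
  by apply: cvgD; [exact: (cvgM c1 c1)|exact: (cvgM c2 c2)].
have -> : disc z r =
    (fun a : R * R => (a.1 - z.1) ^+ 2 + (a.2 - z.2) ^+ 2 : R) @^-1` [set x | x < r ^+ 2] by [].
by apply: open_comp; [move=> a _; exact: c|exact: open_lt].
Qed.

Lemma disc_sub_interior z r (A : set (R * R)) :
  disc z r `<=` A -> disc z r `<=` A°.
Proof.
move=> /interiorS; rewrite [X in X `<=` _](interior_id _).1//.
exact: open_disc.
Qed.

Lemma disc_sub z r1 r2 : 0 <= r1 -> r1 <= r2 -> disc z r1 `<=` disc z r2.
Proof.
move=> r10 r12 a /= /lt_le_trans; apply.
by rewrite lerXn2r// nnegrE (le_trans r10).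
Qed.

(* Four charts of the plane: every direction [(p, q)] has [`|p| <= q] in one of
   them. *)
Definition orient (o : bool * bool) (a : R * R) : R * R :=
  let w := if o.1 then (a.2, a.1) else a in (w.1, (-1) ^+ o.2 * w.2).

Lemma orient_norm o a :
  (orient o a).1 ^+ 2 + (orient o a).2 ^+ 2 = a.1 ^+ 2 + a.2 ^+ 2.
Proof.
by case: o => [[] []]; rewrite /orient/=; ring.
Qed.

Lemma orient_dir p q : p ^+ 2 + q ^+ 2 = 1 ->
  exists o p' q', [/\ p' ^+ 2 + q' ^+ 2 = 1, `|p'| <= q' &
    forall a, p * a.1 + q * a.2 = p' * (orient o a).1 + q' * (orient o a).2].
Proof.
move=> pq1; have [pq|qp] := leP `|p| `|q|.
- exists (false, q < 0), p, `|q|; split=> //.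
    by rewrite real_normK ?num_real.
  move=> a; rewrite /orient/=; case: ltP => q0.
    by rewrite ltr0_norm// expr1; ring.
  by rewrite ger0_norm// expr0; ring.
- exists (true, p < 0), q, `|p|; split=> //; last 2 first.
  + exact: ltW.
  + move=> a; rewrite /orient/=; case: ltP => p0.
      by rewrite ltr0_norm// expr1; ring.
    by rewrite ger0_norm// expr0; ring.
  by rewrite real_normK ?num_real// addrC.
Qed.

(* A curved strip under the circle of radius [r], of width [l ^+ 2], over the
   [c.2]-th interval of length [l] in the chart [c.1]. *)
Definition arc_cell z rho r l (c : (bool * bool) * nat) : set (R * R) :=
  [set a | let w := orient c.1 (a - z) in
    c.2%:R * l - rho <= w.1 < c.2.+1%:R * l - rho /\
    Num.sqrt (r ^+ 2 - w.1 ^+ 2) - l ^+ 2 <= w.2 <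
      Num.sqrt (r ^+ 2 - w.1 ^+ 2)].

(** In a chart where the direction satisfies [|p'| <= q'], take the interval that contains the
    abscissa [r * p'] of the tangency point; [|r * p'| <= rho] bounds its index. *)
Lemma cap_arc_cell z rho r l p q : 0 < rho -> rho / 2 <= r -> r <= rho ->
  0 < l -> l <= 1 -> l <= r / 16 -> p ^+ 2 + q ^+ 2 = 1 ->
  exists2 c, (c.2 <= Num.truncn (2 * rho / l))%N &
    arc_cell z rho r l c `<=` [set a | disc z r a /\
      r - (1 + 10 / rho) * l ^+ 2 <= p * (a.1 - z.1) + q * (a.2 - z.2)].
Proof.
move=> rho0 rrho1 rrho2 l0 l1 lr /orient_dir [ori [p' [q' [pq1 pq opq]]]].
have q1 : q' <= 1.
  rewrite -[_ <= _](@ler_pXn2r _ 2) ?nnegrE//; last by apply: le_trans pq.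
  by have := sqr_ge0 p'; lra.
have rp : `|r * p'| <= rho.
  rewrite normrM (@le_trans _ _ `|r|)//; last by rewrite ger0_norm; lra.
  by rewrite ler_piMr//; lra.
move: rp; rewrite ler_norml => /andP[rp1 rp2].
have t0 : 0 <= (r * p' + rho) / l by rewrite divr_ge0; lra.
exists (ori, Num.truncn ((r * p' + rho) / l)) => /=.
  by apply: le_truncn; rewrite ler_pM2r ?invr_gt0//; lra.
have /andP[] := truncn_itv t0.
rewrite ler_pdivlMr// ltr_pdivrMr//.
set i := Num.truncn _ => i1 i2 a [/andP[a1 a2] a3].
have := opq (a - z); have := orient_norm ori (a - z).
move: (orient ori (a - z)) a1 a2 a3 => w /= a1 a2 a3 wn wpq.
have := arc_near_tangent rho0 rrho1 l0 l1 lr pq1 pq _ a3.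
rewrite wn -wpq; apply.
rewrite ler_norml; move: i2 a2; rewrite -natr1 mulrDl mul1r => i2 a2.
by apply/andP; split; lra.
Qed.

End arcs.

(** * Peeling a set that hits all cells *)

Section peeling.
Variables (R : realType) (phi : R * R -> R).
Hypotheses (phi_norm : is_norm phi)
  (phi_strict : strictly_convex_set [set x | phi x <= 1]).
Implicit Types (r l rho : R) (z a : R * R) (S : set (R * R)).

(** A point [x] of the disc has projection less than [r] in every unit direction, so the half-plane
    through [x] supplied by [norm_lt_halfplane] contains the whole cap in its direction, hence a
    point of [S]. *)
Lemma disc_sub_pareto_hull z r S : 0 <= r ->
  (forall p q : R, p ^+ 2 + q ^+ 2 = 1 ->
    exists2 a, S a & r <= p * (a.1 - z.1) + q * (a.2 - z.2)) ->
  disc z r `<=` pareto_hull phi S.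
Proof.
move=> r0 caps x /= xr y yx.
have [p [q pq1 hpq]] := norm_lt_halfplane phi_norm phi_strict yx.
have [a Sa ra] := caps p q pq1; exists a => //; apply: hpq.
(* Cauchy-Schwarz, through Lagrange's identity with remainder [(p * c - q * b) ^+ 2]. *)
have xlt : (p * (x.1 - z.1) + q * (x.2 - z.2)) ^+ 2 < r ^+ 2.
  apply: le_lt_trans xr; move: (x.1 - z.1) (x.2 - z.2) => b c.
  have := sqr_ge0 (p * c - q * b).
  have -> : b ^+ 2 + c ^+ 2 = (p ^+ 2 + q ^+ 2) * (b ^+ 2 + c ^+ 2).
    by rewrite pq1 mul1r.
  by move=> h; rewrite -subr_ge0; move: h; congr (0 <= _); ring.
have : p * (x.1 - z.1) + q * (x.2 - z.2) < r.
  rewrite ltNge; apply/negP => h; move: xlt; rewrite ltNge => /negP; apply.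
  by rewrite lerXn2r// nnegrE (le_trans r0).
move: ra; set u := p * (a.1 - z.1) + _; set v := p * (x.1 - z.1) + _ => ru vr.
have -> : p * (a.1 - x.1) + q * (a.2 - x.2) = u - v by rewrite /u /v; ring.
lra.
Qed.

(** Induction on [k]. Since discs are open, all points of [S] in the disc reached at one stage
    survive to the next; they hit every cell under its circle, so the next hull loses at most the
    width [w]. The bound on [L%:R * w] keeps all radii above [rho / 2], where the cap estimate is
    uniform. *)
Lemma disc_sub_pareto_peel z rho l (L : nat) S (w := (1 + 10 / rho) * l ^+ 2) :
  0 < rho -> 0 < l -> l <= 1 -> l <= rho / 32 -> L%:R * w <= rho / 2 ->
  (forall c (k : nat), (c.2 <= Num.truncn (2 * rho / l))%N -> (k < L)%N ->
    S `&` arc_cell z rho (rho - k%:R * w) l c !=set0) ->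
  forall k, (k < L)%N -> disc z (rho - k.+1%:R * w) `<=` pareto_peel phi S k.
Proof.
move=> rho0 l0 l1 lrho Lw hit.
have w0 : 0 <= w by rewrite /w mulr_ge0 ?sqr_ge0// addr_ge0// divr_ge0// ltW.
have rad k : (k <= L)%N -> rho / 2 <= rho - k%:R * w.
  move=> kL; have : k%:R * w <= L%:R * w by rewrite ler_wpM2r// ler_nat.
  lra.
have step k T : (k < L)%N -> S `&` disc z (rho - k%:R * w) `<=` T ->
    disc z (rho - k.+1%:R * w) `<=` pareto_hull phi T.
  move=> kL ST; apply: disc_sub_pareto_hull.
    by have := rad _ kL; lra.
  move=> p q pq1; have rk := rad _ (ltnW kL).
  have kw0 : 0 <= k%:R * w by rewrite mulr_ge0.
  have [||c cN hc] :=
    @cap_arc_cell R z rho (rho - k%:R * w) l p q rho0 rk _ l0 l1 _ pq1.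
  - lra.
  - lra.
  have [a [Sa /hc[da ha]]] := hit c k cN kL.
  exists a; first exact: ST.
  by apply: le_trans ha; rewrite -natr1 mulrDl mul1r /w; lra.
elim=> [|k IH] kL; first by apply: step => // a [].
apply: (step k.+1) => // a [Sa da]; split => //.
by apply: disc_sub_interior da; apply: IH; exact: ltnW.
Qed.

Lemma pareto_height_ge S (L : nat) x :
  (forall k, (k < L)%N -> (pareto_peel phi S k)° x) ->
  (L%:R%:E <= pareto_height phi S x)%E.
Proof.
move=> hx; rewrite /pareto_height.
have := @nneseries_lim_ge R
  (fun k => (\1_((pareto_peel phi S k)°) x)%:E) xpredT 0 L.
move=> /(_ _)/(le_trans _); apply; last by move=> k _ _; rewrite lee_fin.
rewrite (@eq_big_nat _ _ _ _ _ _ (fun _ => 1%:E)).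
  by rewrite sumEFin big_mkord sumr_const card_ord.
by move=> k /andP[_ kL]; rewrite indicE mem_set//; exact: hx.
Qed.

Lemma disc_sub_pareto_height z rho l (L : nat) S
    (w := (1 + 10 / rho) * l ^+ 2) :
  0 < rho -> 0 < l -> l <= 1 -> l <= rho / 32 -> L%:R * w <= rho / 2 ->
  (forall c (k : nat), (c.2 <= Num.truncn (2 * rho / l))%N -> (k < L)%N ->
    S `&` arc_cell z rho (rho - k%:R * w) l c !=set0) ->
  forall x, disc z (rho / 2) x -> (L%:R%:E <= pareto_height phi S x)%E.
Proof.
move=> rho0 l0 l1 lrho Lw hit x dx; apply: pareto_height_ge => k kL.
have := disc_sub_pareto_peel rho0 l0 l1 lrho Lw hit kL.
rewrite -/w => sub; apply: (disc_sub_interior _ dx).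
apply: subset_trans sub; apply: disc_sub; first by lra.
have : k.+1%:R * w <= L%:R * w.
  rewrite ler_wpM2r ?ler_nat// /w mulr_ge0 ?sqr_ge0// addr_ge0// divr_ge0//.
  exact: ltW.
lra.
Qed.

End peeling.

(** * Areas and void probabilities of cells *)

Section area.
Variable R : realType.
Local Notation mu := (@lebesgue_measure R).
Implicit Types (C : set (R * R)) (I : set R) (h l r rho : R) (z : R * R).

(* Unlike [ge0_le_integral], this needs no measurability. *)
Lemma ge0_le_integral_nonmeas d (T : measurableType d)
    (m : {measure set T -> \bar R}) (D : set T) (f g : T -> \bar R) :
  (forall x, D x -> (0 <= f x)%E) -> (forall x, D x -> (f x <= g x)%E) ->
  (\int[m]_(x in D) f x <= \int[m]_(x in D) g x)%E.
Proof.
move=> f0 fg.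
rewrite !ge0_integralE//; last first.
  by move=> x Dx; apply: le_trans (fg x Dx); exact: f0.
apply: ereal_sup_le => _ [k /= kf <-]; exists k => //= x.
apply: (le_trans (kf x)); rewrite /patch; case: ifPn => // /set_mem; exact: fg.
Qed.

Lemma integral_section (f : measurableTypeR R -> \bar R)
    (I : set (measurableTypeR R)) h : measurable I -> 0 <= h ->
  (forall x, f x = (h * \1_I x)%:E) ->
  (\int[mu]_x f x = h%:E * mu I)%E.
Proof.
move=> mI h0 fE.
rewrite (eq_integral
  (fun x : measurableTypeR R => h%:E * (\1_I x)%:E)%E).
  by rewrite ge0_integralZl ?integral_indic ?setIT//; exact: measurableT_comp.
by move=> x _; rewrite fE EFinM.
Qed.

Lemma area_xsection C I h : measurable I -> 0 <= h ->
  (forall x, mu (xsection C x) = (h * \1_I x)%:E) ->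
  ((mu \x mu) C = h%:E * mu I)%E.
Proof. by move=> mI h0 CE; apply: integral_section. Qed.

Lemma area_ysection C I h : measurable C -> measurable I -> 0 <= h ->
  (forall y, mu (ysection C y) = (h * \1_I y)%:E) ->
  ((mu \x mu) C = h%:E * mu I)%E.
Proof.
move=> mC mI h0 CE.
(* [mu \x mu] integrates the measures of [x]-sections; uniqueness of the product measure allows
   integrating those of [y]-sections instead. *)
transitivity ((mu \x^ mu) C)%E; last exact: integral_section.
by apply: product_measure_unique => // A B mA mB; exact: product_measure2E.
Qed.

Lemma measurable_le_funs (f g : R * R -> R) : measurable_fun setT f ->
  measurable_fun setT g -> measurable [set a | f a <= g a].
Proof.
move=> mf mg; have := measurable_fun_ler mf mg => /(_ measurableT [set true] I).
by rewrite setTI.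
Qed.

Lemma measurable_lt_funs (f g : R * R -> R) : measurable_fun setT f ->
  measurable_fun setT g -> measurable [set a | f a < g a].
Proof.
move=> mf mg; have := measurable_fun_ltr mf mg => /(_ measurableT [set true] I).
by rewrite setTI.
Qed.

Lemma measurable_arc_cell z rho r l c : measurable (arc_cell z rho r l c).
Proof.
have m1 : measurable_fun setT (fun a : R * R => a.1 - z.1).
  by apply: measurable_funB => //; exact: measurable_fst.
have m2 : measurable_fun setT (fun a : R * R => a.2 - z.2).
  by apply: measurable_funB => //; exact: measurable_snd.
have mX : measurable_fun setT (fun a : R * R => (orient c.1 (a - z)).1).
  by case: (c) => [[[] e] i].
have mY : measurable_fun setT (fun a : R * R => (orient c.1 (a - z)).2).
  by case: (c) => [[[] e] i]; apply: measurable_funM.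
have ms : measurable_fun setT
    (fun a : R * R => Num.sqrt (r ^+ 2 - (orient c.1 (a - z)).1 ^+ 2)).
  apply: measurableT_comp.
    exact: continuous_measurable_fun (@sqrt_continuous R).
  by apply: measurable_funB => //; apply: measurable_funX.
have -> : arc_cell z rho r l c =
  [set a | c.2%:R * l - rho <= (orient c.1 (a - z)).1] `&`
  [set a | (orient c.1 (a - z)).1 < c.2.+1%:R * l - rho] `&`
  ([set a | Num.sqrt (r ^+ 2 - (orient c.1 (a - z)).1 ^+ 2) - l ^+ 2 <=
      (orient c.1 (a - z)).2] `&`
  [set a | (orient c.1 (a - z)).2 <
      Num.sqrt (r ^+ 2 - (orient c.1 (a - z)).1 ^+ 2)]).
  by apply/seteqP; split=> a; [move=> [/andP[? ?] /andP[? ?]]|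
    move=> [[? ?] [? ?]]; split; apply/andP].
apply: measurableI; apply: measurableI.
- exact: measurable_le_funs.
- exact: measurable_lt_funs.
- by apply: measurable_le_funs => //; exact: measurable_funB.
- exact: measurable_lt_funs.
Qed.

(** Cavalieri: over a base of length [l], each section is an interval of length [l ^+ 2]. This
    persists beyond the circle, where [Num.sqrt] of a negative number is 0. *)
Lemma area_arc_cell z rho r l c : 0 < l ->
  ((mu \x mu) (arc_cell z rho r l c) = (l ^+ 3)%:E)%E.
Proof.
move=> l0; have h0 : 0 <= l ^+ 2 by rewrite sqr_ge0.
have lenI (w : R) :
    mu `[(c.2%:R * l - rho + w), (c.2.+1%:R * l - rho + w)[ = l%:E.
  rewrite lebesgue_measure_itv/= lte_fin ltrD2r ltrD2r ltr_pM2r// ltr_nat ltnSn.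
  by rewrite -EFinD -natr1; congr EFin; ring.
have -> : (l ^+ 3)%:E = ((l ^+ 2)%:E * l%:E)%E by rewrite -EFinM -exprSr.
have sec (w s : R) e :
    mu [set y | s - l ^+ 2 <= (-1) ^+ (e : bool) * (y - w) < s] =
    (l ^+ 2)%:E.
  have l20 : 0 < l ^+ 2 by rewrite exprn_gt0.
  case: e.
  - rewrite (_ : [set y | _] = [set` `]w - s, (w - s + l ^+ 2)]]).
      rewrite lebesgue_measure_itv/= lte_fin ltrDl l20 -EFinD.
      by congr EFin; ring.
    apply/seteqP; split => y /=; rewrite in_itv/= expr1 => /andP[? ?];
      by apply/andP; split; lra.
  - rewrite (_ : [set y | _] = [set` `[(w + s - l ^+ 2), (w + s)[]).
      rewrite lebesgue_measure_itv/= lte_fin ltrBlDr ltrDl l20 -EFinD.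
      by congr EFin; ring.
    apply/seteqP; split => y /=; rewrite in_itv/= expr0 => /andP[? ?];
      by apply/andP; split; lra.
have sect (A : set R) (J : set R) (x w s : R) e :
    A = [set y | J x /\ s - l ^+ 2 <= (-1) ^+ (e : bool) * (y - w) < s] ->
    mu A = (l ^+ 2 * \1_J x)%:E.
  move=> ->; rewrite indicE; have [Jx|Jx] := pselect (J x).
    rewrite mem_set// mulr1 -(sec w s e); congr mu; apply/seteqP.
    by split => y /=; [case|].
  rewrite memNset// mulr0 (_ : [set y | _] = set0) ?measure0//.
  by apply/seteqP; split => y //= -[].
have mC := measurable_arc_cell z rho r l c.
(* Charts that swap the coordinates are sliced along [y], the others along [x]. *)
case: c => [[[] e] i] in lenI mC *.
- rewrite -(lenI z.2); apply: area_ysection => // y.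
  apply: (sect _ _ y z.1 (Num.sqrt (r ^+ 2 - (y - z.2) ^+ 2)) e).
  rewrite ysectionE; apply/seteqP; split => x; rewrite /arc_cell/= in_itv/=.
    by move=> [/andP[? ?] ->]; split=> //; apply/andP; split; lra.
  by move=> [/andP[? ?] ->]; split=> //; apply/andP; split; lra.
- rewrite -(lenI z.1); apply: area_xsection => // x.
  apply: (sect _ _ x z.2 (Num.sqrt (r ^+ 2 - (x - z.1) ^+ 2)) e).
  rewrite xsectionE; apply/seteqP; split => y; rewrite /arc_cell/= in_itv/=.
    by move=> [/andP[? ?] ->]; split=> //; apply/andP; split; lra.
  by move=> [/andP[? ?] ->]; split=> //; apply/andP; split; lra.
Qed.

End area.

Section void_probabilities.
Variables (R : realType) (d : measure_display) (Omega : measurableType d).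
Variable P : probability Omega R.
Local Notation mu := (@lebesgue_measure R).
Implicit Types (U B : set (R * R)) (X : Omega -> set (R * R)).

Lemma npoints_void X B w : X w `&` B = set0 -> npoints X B w = 0%E.
Proof.
by move=> XB; rewrite /npoints XB /counting asboolT// fset_set0 finmap.cardfs0.
Qed.

Lemma measurable_void U g X B : is_poisson_process P U g X ->
  measurable B -> B `<=` U -> measurable [set w | npoints X B w = 0%E].
Proof.
move=> [_ mX _ _] mB BU.
have := mX B mB BU measurableT [set 0%E] (emeasurable_set1 _).
by rewrite setTI.
Qed.

Lemma poisson_void_le U (g : R * R -> R) X B (v a b : R) :
  is_poisson_process P U g X -> measurable B -> B `<=` U ->
  (mu \x mu)%E B = v%:E -> 0 < v -> 0 < a ->
  (forall x, B x -> a <= g x <= b) ->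
  (P [set w | npoints X B w = 0] <= (expR (- (a * v)))%:E)%E.
Proof.
move=> [_ _ pX _] mB BU Bv v0 a0 gab.
have := pX B mB BU 0%N; rewrite mulr0n => ->.
set I := (\int[_]_(_ in _) _)%E.
have cstI (c : R) : (\int[mu \x mu]_(x in B) (cst c%:E) x)%E = (c * v)%:E.
  by rewrite integral_cst//; rewrite [X in (_ * X)%E]Bv.
have I1 : ((a * v)%:E <= I)%E.
  rewrite -cstI; apply: ge0_le_integral_nonmeas => x Bx.
    by rewrite lee_fin ltW.
  by rewrite lee_fin; have /andP[] := gab x Bx.
have I2 : (I <= (b * v)%:E)%E.
  rewrite -cstI; apply: ge0_le_integral_nonmeas => x Bx; rewrite lee_fin.
    by have /andP[/(le_trans (ltW a0))] := gab x Bx.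
  by have /andP[] := gab x Bx.
(* The upper bound [b] keeps the integral finite, so that [fine] returns its value and not the
   default 0. *)
have Ifin : I \is a fin_num by rewrite fin_numE; apply/andP; split;
  [rewrite gt_eqF// (lt_le_trans _ I1)// ltNyr|
   rewrite lt_eqF// (le_lt_trans I2)// ltry].
have If : a * v <= fine I by rewrite -lee_fin fineK.
have I0 : 0 < fine I by apply: lt_le_trans If; rewrite mulr_gt0.
rewrite /poisson_prob I0 esum_set1; last by rewrite lee_fin poisson_pmf_ge0.
rewrite /poisson_pmf I0 expr0 fact0 invr1 !mul1r lee_fin ler_expR.
by rewrite lerN2.
Qed.

Lemma measure_bigsetU_le (I : Type) (s : seq I) (F : I -> set Omega) (b : R) :
  (forall i, measurable (F i)) -> (forall i, (P (F i) <= b%:E)%E) ->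
  (P (\big[setU/set0]_(i <- s) F i) <= ((size s)%:R * b)%:E)%E.
Proof.
move=> mF Fb; elim: s => [|i s IH]; first by rewrite big_nil measure0 mul0r.
rewrite big_cons; apply: (le_trans (measureU2 _ _ _)) => //.
  exact: bigsetU_measurable.
rewrite /= -natr1 mulrDl mul1r addrC EFinD; exact: leeD.
Qed.

Lemma sum_inv_sqr_lty (u : nat -> \bar R) (C : R) : 0 <= C ->
  (forall n, (0 <= u n)%E) ->
  (forall n, (u n <= (C / n.+1%:R ^+ 2)%:E)%E) -> (\sum_(n <oo) u n < +oo)%E.
Proof.
move=> C0 u0 uC.
apply: (@le_lt_trans _ _ (C * 2)%:E); last exact: ltry.
apply: lime_le; first by apply: is_cvg_nneseries => n _ _.
apply: nearW => N.
(* A telescoping majorant: [1 / x ^+ 2 <= 2 / x - 2 / (x + 1)] for [x >= 1]. *)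
have h : (\sum_(0 <= i < N) u i <= (C * (2 - 2 / N.+1%:R))%:E)%E.
  elim: N => [|N IH]; first by rewrite big_nil lee_fin invr1 mulr1 subrr mulr0.
  rewrite big_nat_recr//=; apply: (le_trans (leeD IH (uC N))).
  rewrite -EFinD lee_fin -mulrDr ler_wpM2l//.
  have N1 : 0 < N.+1%:R :> R by rewrite ltr0n.
  have -> : N.+2%:R = N.+1%:R + 1 :> R by rewrite -natr1.
  move: N1; set x := N.+1%:R => N1; have x1 : 1 <= x by rewrite /x ler1n.
  rewrite -subr_ge0.
  have -> : 2 - 2 / (x + 1) - (2 - 2 / x + (x ^+ 2)^-1) =
            (x - 1) / (x ^+ 2 * (x + 1)).
    by field; apply/andP; split; rewrite gt_eqF//; lra.
  rewrite divr_ge0 ?mulr_ge0 ?sqr_ge0//; lra.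
apply: (le_trans h); rewrite lee_fin ler_wpM2l// gerBl.
by rewrite divr_ge0.
Qed.

(** A single term of the exponential series already dominates the power. This is how void
    probabilities beat the polynomial number of cells. *)
Lemma expRN_le_inv k : exists2 m : R, 0 <= m &
  forall x : R, 0 < x -> expR (- x) <= m / x ^+ k.+1.
Proof.
exists (k.+1`!%:R) => [|x x0]; first exact: ler0n.
rewrite expRN ler_pdivlMr ?exprn_gt0// ler_pdivrMl ?expR_gt0//.
rewrite -ler_pdivrMr ?ltr0n ?fact_gt0//.
by have := expR_ge1Dxn k (ltW x0); lra.
Qed.

End void_probabilities.

(** * Almost sure growth of the height *)

Section almost_sure_growth.
Variables (R : realType) (phi : R * R -> R).
Hypotheses (phi_norm : is_norm phi)
  (phi_strict : strictly_convex_set [set x | phi x <= 1]).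
Variables (d : measure_display) (Omega : measurableType d).
Variable P : probability Omega R.
Implicit Types (rho r l q A : R) (z : R * R) (U : set (R * R)).

(** In its chart a cell has abscissas at most [2 * rho] and ordinates at most [rho] in absolute
    value, and [4 + 1 < 9]. *)
Lemma arc_cell_sub_disc z rho r l c : 0 < rho -> 0 <= r <= rho ->
  0 < l -> l <= 1 -> l <= rho / 32 ->
  (c.2 <= Num.truncn (2 * rho / l))%N ->
  arc_cell z rho r l c `<=` disc z (3 * rho).
Proof.
move=> rho0 /andP[r0 r1] l0 l1 lrho cN a [/andP[X1 X2] /andP[Y1 Y2]].
have cl : c.2%:R * l <= 2 * rho.
  rewrite -ler_pdivlMr//; apply: (@le_trans _ _ (Num.truncn (2 * rho / l))%:R).
    by rewrite ler_nat.
  by rewrite truncn_le divr_ge0 ?mulr_ge0 ?ltW.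
have := orient_norm c.1 (a - z); rewrite /disc.
move: (orient c.1 (a - z)) X1 X2 Y1 Y2 => w /= X1 + + + <-.
rewrite -natr1 mulrDl mul1r => X2; set s := Num.sqrt _ => Y1 Y2.
have cl0 : 0 <= c.2%:R * l by rewrite mulr_ge0// ltW.
have s0 : 0 <= s by rewrite sqrtr_ge0.
have s1 : s <= rho.
  apply: le_trans r1; rewrite -[leRHS](ger0_norm r0) -sqrtr_sqr ler_wsqrtr//.
  by rewrite gerBl sqr_ge0.
have ll : l ^+ 2 <= l by rewrite expr2 ger_pMr.
have X3 : w.1 ^+ 2 <= (2 * rho) ^+ 2.
  rewrite -[leLHS]real_normK ?num_real// lerXn2r ?nnegrE//; first by lra.
  by rewrite ler_norml; apply/andP; split; lra.
have Y3 : w.2 ^+ 2 <= rho ^+ 2.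
  rewrite -[leLHS]real_normK ?num_real// lerXn2r ?nnegrE ?(ltW rho0)//.
  by rewrite ler_norml; apply/andP; split; lra.
have : 0 < rho ^+ 2 by rewrite exprn_gt0.
move: X3; rewrite !exprMn; lra.
Qed.

(** [E] is the event that some cell is void. There are four charts, [(Num.truncn (2 * rho / l)).+1]
    intervals and [L] circles, and each cell has area [l ^+ 3]. *)
Lemma poisson_height_ge U (g : R * R -> R) X z rho l (L : nat) (a b : R) :
  is_poisson_process P U g X ->
  0 < rho -> 0 < l -> l <= 1 -> l <= rho / 32 ->
  L%:R * ((1 + 10 / rho) * l ^+ 2) <= rho / 2 ->
  disc z (3 * rho) `<=` U -> 0 < a ->
  (forall x, disc z (3 * rho) x -> a <= g x <= b) ->
  exists E : set Omega, [/\ measurable E,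
    (P E <= ((4 * (Num.truncn (2 * rho / l)).+1 * L)%:R *
      expR (- (a * l ^+ 3)))%:E)%E &
    forall w, ~ E w -> forall x, disc z (rho / 2) x ->
      (L%:R%:E <= pareto_height phi (X w) x)%E].
Proof.
move=> pX rho0 l0 l1 lrho Lw discU a0 gab.
set N := Num.truncn _; set v := (1 + 10 / rho) * l ^+ 2 in Lw *.
have v0 : 0 <= v by rewrite /v mulr_ge0 ?sqr_ge0// addr_ge0// divr_ge0// ltW.
pose T : finType := ((bool * bool) * 'I_N.+1 * 'I_L)%type.
pose cell (t : T) := arc_cell z rho (rho - t.2%:R * v) l (t.1.1, val t.1.2).
have mcell t : measurable (cell t) by exact: measurable_arc_cell.
have celldisc t : cell t `<=` disc z (3 * rho).
  apply: arc_cell_sub_disc => //; last exact: (ltn_ord t.1.2).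
  have : t.2%:R * v <= L%:R * v by rewrite ler_wpM2r// ler_nat ltnW.
  have : 0 <= t.2%:R * v by rewrite mulr_ge0.
  by move=> ? ?; apply/andP; split; lra.
have cellU t : cell t `<=` U by apply: subset_trans (celldisc t) discU.
pose F t := [set w | npoints X (cell t) w = 0%E].
exists (\big[setU/set0]_(t <- enum T) F t); split.
- by apply: bigsetU_measurable => t _; exact: measurable_void pX _ _.
- have -> : (4 * N.+1 * L)%N = size (enum T).
    by rewrite -cardT !card_prod card_bool !card_ord.
  apply: measure_bigsetU_le => t; first exact: measurable_void pX _ _.
  apply: (poisson_void_le pX (b := b)) => //.
  + exact: area_arc_cell.
  + exact: exprn_gt0.
  + by move=> x /celldisc; exact: gab.
- move=> w nE.
  apply: (disc_sub_pareto_height phi_norm phi_strict rho0 l0 l1 lrho Lw).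
  move=> c k cN kL.
  apply/set0P; apply: contra_notN nE => /eqP XC.
  rewrite -bigcup_seq.
  exists (c.1, Ordinal (cN : (c.2 < N.+1)%N), Ordinal kL).
    by rewrite /= mem_enum.
  by apply: npoints_void; case: c cN XC.
Qed.

(** About [A * q ^+ 2] layers of width proportional to [(dl / q) ^+ 2] have a total width that does
    not grow with [q], so one small [dl] serves all [q]. *)
Lemma layer_scale rho A : 0 < rho -> 0 <= A ->
  exists2 dl : R, 0 < dl & forall q, 1 <= q ->
    [/\ 0 < dl / q, dl / q <= 1, dl / q <= rho / 32 &
     (Num.truncn (A * q ^+ 2)).+1%:R * ((1 + 10 / rho) * (dl / q) ^+ 2) <=
       rho / 2].
Proof.
move=> rho0 A0; pose K := 1 + 10 / rho.
have K0 : 0 < K by rewrite /K addr_gt0// divr_gt0.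
have A1 : 0 < A + 1 by lra.
have KA : 0 < 2 * K * (A + 1) by rewrite !mulr_gt0.
(* The last term gives [K * (A + 1) * dl <= rho / 2]; with [dl <= 1] the same bound holds for
   [dl ^+ 2]. *)
pose dl := Num.min 1 (Num.min (rho / 32) (rho / (2 * K * (A + 1)))).
have dl0 : 0 < dl by rewrite !lt_min ltr01 !divr_gt0.
have [dl1 dl2 dl3] :
    [/\ dl <= 1, dl <= rho / 32 & dl * (2 * K * (A + 1)) <= rho].
  split; first by rewrite ge_min lexx.
    by rewrite !ge_min lexx orbT.
  by rewrite -ler_pdivlMr// !ge_min lexx !orbT.
exists dl => // q q1; have q0 : 0 < q by lra.
have le1 : dl / q <= dl by rewrite ler_pdivrMr// ler_peMr// ltW.
split; [exact: divr_gt0|exact: le_trans dl1|exact: le_trans dl2|].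
have L1 : (Num.truncn (A * q ^+ 2)).+1%:R <= (A + 1) * q ^+ 2.
  have Aq0 : 0 <= A * q ^+ 2 by rewrite mulr_ge0 ?sqr_ge0.
  have := truncn_le (A * q ^+ 2); rewrite Aq0 -natr1 mulrDl mul1r.
  have : 1 <= q ^+ 2 by rewrite expr_ge1// ltW.
  by move=> ? ?; lra.
apply: (@le_trans _ _ ((A + 1) * q ^+ 2 * (K * (dl / q) ^+ 2))).
  by rewrite ler_wpM2r// mulr_ge0 ?sqr_ge0// ltW.
have -> : (A + 1) * q ^+ 2 * (K * (dl / q) ^+ 2) = K * (A + 1) * dl ^+ 2.
  by field; rewrite gt_eqF.
have : dl * dl * (2 * K * (A + 1)) <= 1 * rho.
  rewrite -mulrA ler_pM// ?ltW// mulr_gt0//.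
by rewrite expr2; lra.
Qed.

Lemma ae_height_growth U (f : R * R -> R) (X : nat -> Omega -> set (R * R))
    z rho A (c M : R) :
  (forall n, (0 < n)%N -> is_poisson_process P U (fun x => n%:R * f x) (X n)) ->
  0 < rho -> 0 <= A -> disc z (3 * rho) `<=` U -> 0 < c ->
  (forall x, disc z (3 * rho) x -> c <= f x <= M) ->
  \forall w \ae P, \forall n \near \oo, forall x, disc z (rho / 2) x ->
    ((A * Num.sqrt n%:R)%:E <= pareto_height phi (X n w) x)%E.
Proof.
move=> pX rho0 A0 discU c0 cfM; have [dl dl0 scale] := layer_scale rho0 A0.
(* The fourth root of [n.+1]; the shift by one ensures [q n >= 1] and a positive intensity. *)
pose q (n : nat) : R := Num.sqrt (Num.sqrt n.+1%:R).
pose L n := (Num.truncn (A * q n ^+ 2)).+1.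
have q2 n : q n ^+ 2 = Num.sqrt n.+1%:R by rewrite sqr_sqrtr// sqrtr_ge0.
have q4 n : q n ^+ 4 = n.+1%:R by rewrite (exprM _ 2 2) q2 sqr_sqrtr.
have q1 n : 1 <= q n.
  by rewrite -[leLHS]sqrtr1 ler_wsqrtr// -[leLHS]sqrtr1 ler_wsqrtr// ler1n.
have q0 n : 0 < q n by apply: lt_le_trans (q1 n).
have hE n : exists E : set Omega, [/\ measurable E,
    (P E <= ((4 * (Num.truncn (2 * rho / (dl / q n))).+1 * L n)%:R *
      expR (- (n.+1%:R * c * (dl / q n) ^+ 3)))%:E)%E &
    forall w, ~ E w -> forall x, disc z (rho / 2) x ->
      ((L n)%:R%:E <= pareto_height phi (X n.+1 w) x)%E].
  have [l0 l1 l2 l3] := scale _ (q1 n).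
  apply: (poisson_height_ge (pX n.+1 isT) (b := n.+1%:R * M)) => //.
    by rewrite mulr_gt0// ltr0n.
  move=> x /cfM /andP[cf fM]; apply/andP; split; by rewrite ler_wpM2l.
have {hE} [E hE] := choice hE.
(* The exponent is 11 because the number of cells is of order [q n ^+ 3] and summability is obtained
   from [n.+1 ^- 2 = q n ^- 8]. *)
have [m m0 hm] := expRN_le_inv R 10.
pose C := 4 * (2 * rho / dl + 1) * (A + 1) * (m / (c * dl ^+ 3) ^+ 11).
have cd0 : 0 < c * dl ^+ 3 by rewrite mulr_gt0// exprn_gt0.
have C0 : 0 <= C.
  by rewrite /C !mulr_ge0 ?invr_ge0 ?exprn_ge0 ?addr_ge0 ?mulr_ge0 ?invr_ge0
    ?(ltW rho0) ?(ltW dl0)// ltW.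
have PE n : (P (E n) <= (C / n.+1%:R ^+ 2)%:E)%E.
  have [_ + _] := hE n; move=> /le_trans; apply; rewrite lee_fin.
  have qn0 := q0 n; have qn1 := q1 n.
  (* Intensity of order [q n ^+ 4] times area of order [q n ^- 3]: the expected number of points in
     a cell grows like [q n]. *)
  have -> : n.+1%:R * c * (dl / q n) ^+ 3 = c * dl ^+ 3 * q n.
    by rewrite -(q4 n); field; rewrite gt_eqF.
  have e1 := hm _ (mulr_gt0 cd0 qn0).
  have N1 : (Num.truncn (2 * rho / (dl / q n))).+1%:R <=
      (2 * rho / dl + 1) * q n.
    have t0 : 0 <= 2 * rho / (dl / q n) by rewrite !divr_ge0 ?mulr_ge0 ?ltW.
    have := truncn_le (2 * rho / (dl / q n)); rewrite t0 -natr1.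
    have -> : 2 * rho / (dl / q n) = 2 * rho / dl * q n.
      by field; rewrite !gt_eqF.
    by rewrite mulrDl mul1r; lra.
  have L1 : (L n)%:R <= (A + 1) * q n ^+ 2.
    have Aq0 : 0 <= A * q n ^+ 2 by rewrite mulr_ge0 ?sqr_ge0.
    have := truncn_le (A * q n ^+ 2); rewrite Aq0 /L -natr1 mulrDl mul1r.
    have : 1 <= q n ^+ 2 by rewrite expr_ge1// ltW.
    by move=> ? ?; lra.
  rewrite !natrM.
  apply: (@le_trans _ _ (4 * ((2 * rho / dl + 1) * q n) * ((A + 1) * q n ^+ 2) *
      (m / (c * dl ^+ 3 * q n) ^+ 11))).
    rewrite ler_pM ?expR_ge0 ?mulr_ge0//.
    by rewrite ler_pM ?mulr_ge0// ler_wpM2l.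
  rewrite -(q4 n) /C.
  by rewrite le_eqVlt; apply/orP; left; apply/eqP; field; rewrite !gt_eqF.
(* Borel-Cantelli: outside this null set only finitely many [E n] occur. *)
exists (lim_sup_set E); split.
- apply: bigcap_measurable => // k _.
  by apply: bigcup_measurable => j _; have [] := hE j.
- apply: lim_sup_set_cvg0; first by move=> k; have [] := hE k.
  exact: sum_inv_sqr_lty C0 _ PE.
- move=> w; apply: contra_notP => nlim.
  have [N hN] : exists N, forall n, (N <= n)%N -> ~ E n w.
    apply: contra_notP nlim => nN k _.
    apply: contra_notP nN => nk; exists k => n kn En.
    by apply: nk; exists n.
  (* [E n] controls [X n.+1], hence the threshold [N.+1]. *)
  exists N.+1 => // -[//|n] /= Nn x dx.
  have [_ _ /(_ w (hN n Nn) x dx)] := hE n; apply: le_trans.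
  by rewrite lee_fin -q2 ltW// truncnS_gt.
Qed.

End almost_sure_growth.

(** * Rational discs, compactness and the almost sure limit *)

(** Rational centres and radii leave countably many discs, so their exceptional null sets can be
    united. The centre is within [r / 4] of [x] in each coordinate and [r < e / 4], so the tripled
    disc stays in the square of half-side [e] around [x]. *)
Lemma rational_disc (R : realType) (x : R * R) (O : set (R * R)) : nbhs x O ->
  exists z1 z2 rho : rat, [/\ 0 < ratr rho :> R,
    disc (ratr z1, ratr z2) (ratr rho / 2) x &
    disc (ratr z1, ratr z2) (3 * ratr rho) `<=` O].
Proof.
move=> /nbhs_ballP[e /= e0 xO].
have [rho] := @rat_in_itvoo R 0 (e / 4) (divr_gt0 e0 (ltr0n _ 4)).
rewrite in_itv/= => /andP[rho0 rhoe].
set r : R := ratr rho in rho0 rhoe *.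
have r4 : 0 < r / 4 by lra.
have near (t : R) : exists s : rat, `|t - ratr s| < r / 4.
  have [s] := @rat_in_itvoo R (t - r / 4) (t + r / 4) ltac:(lra).
  rewrite in_itv/= => /andP[s1 s2]; exists s.
  by rewrite ltr_norml; apply/andP; split; lra.
have sqr_lt (t u : R) : `|t| < u -> t ^+ 2 < u ^+ 2.
  move=> tu; rewrite -[ltLHS]real_normK ?num_real// ltrXn2r//.
have lt_sqr (t u : R) : 0 <= u -> t ^+ 2 < u ^+ 2 -> `|t| < u.
  move=> u0; rewrite -[X in X < _]real_normK ?num_real// => tu.
  by rewrite ltNge; apply/negP => ut; move: tu; rewrite ltNge lerXn2r ?nnegrE.
have [z1 h1] := near x.1; have [z2 h2] := near x.2.
have r20 : 0 < r ^+ 2 by rewrite exprn_gt0.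
exists z1, z2, rho; split => //.
- change ((x.1 - ratr z1) ^+ 2 + (x.2 - ratr z2) ^+ 2 < (r / 2) ^+ 2).
  have -> : (r / 2) ^+ 2 = r ^+ 2 / 4 by field.
  have e4 : (r / 4) ^+ 2 = r ^+ 2 / 16 by field.
  by have := sqr_lt _ _ h1; have := sqr_lt _ _ h2; rewrite e4; lra.
- move=> a da; apply: xO.
  have ha : (a.1 - ratr z1) ^+ 2 + (a.2 - ratr z2) ^+ 2 < (3 * r) ^+ 2 := da.
  have a1 : `|a.1 - ratr z1| < 3 * r.
    by apply: lt_sqr; [lra|have := sqr_ge0 (a.2 - ratr z2); lra].
  have a2 : `|a.2 - ratr z2| < 3 * r.
    by apply: lt_sqr; [lra|have := sqr_ge0 (a.1 - ratr z1); lra].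
  split; rewrite /ball/=.
    have := ler_distD (ratr z1) x.1 a.1; rewrite (distrC (ratr z1)); lra.
  have := ler_distD (ratr z2) x.2 a.2; rewrite (distrC (ratr z2)); lra.
Qed.

Theorem corollary1p1 (R : realType) (phi : R * R -> R)
    (phi_norm : is_norm phi)
    (phi_strict : strictly_convex_set [set x | phi x <= 1])
    (U : set (R * R)) (U_bounded : bounded_set U) (U_open : open U)
    (U_efficient : pareto_efficient phi U)
    (f : R * R -> R) (f_pos : forall x, U x -> 0 < f x)
    (f_bounded : [bounded f x | x in U])
    (f_cont : {within U, continuous f})
    (d : measure_display) (Omega : measurableType d) (P : probability Omega R)
    (X : nat -> Omega -> set (R * R))
    (X_poisson : forall n : nat, (0 < n)%N ->
      is_poisson_process P U (fun x => n%:R * f x) (X n)) :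
  {ae P, forall w : Omega, forall K : set (R * R), compact K -> K `<=` U ->
    ereal_inf [set ((Num.sqrt n%:R)^-1%:E * pareto_height phi (X n w) x)%E
              | x in K] @[n --> \oo] --> +oo%E}.
Proof.
have [M hM] : exists M, forall x, U x -> `|f x| <= M.
  have /pinfty_ex_gt0[M _ hM] := f_bounded.
  by exists M => x Ux; exact: hM.
have fU x : U x -> {for x, continuous f}.
  move=> Ux; move: f_cont; rewrite continuous_open_subspace// => /(_ x).
  by apply; rewrite inE.
(* Discs on which the intensity is bounded away from 0. *)
pose good (z : R * R) (rho : R) := 0 < rho /\ disc z (3 * rho) `<=` U /\
  exists2 c, 0 < c & forall x, disc z (3 * rho) x -> c <= f x.
pose growth z rho (A : nat) w := good z rho ->
  \forall n \near \oo, forall x, disc z (rho / 2) x ->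
    ((A%:R * Num.sqrt n%:R)%:E <= pareto_height phi (X n w) x)%E.
(* Rational discs and integer factors [A] are enumerated by [unpickle], which gives a single null
   set outside of which [growth] holds for all of them. *)
have growth_ae : \forall w \ae P, forall k,
    if unpickle k is Some (z1, z2, rho, A)
    then growth (ratr z1, ratr z2) (ratr rho) A w else True.
  apply: ae_foralln => k; case: unpickle => [[[[z1 z2] rho] A]|]; last first.
    exact: nearW.
  have [gz|ngz] := pselect (good (ratr z1, ratr z2) (ratr rho)); last first.
    by apply: nearW => w gz; case: (ngz gz).
  have [rho0 [discU [c c0 cf]]] := gz.
  have := @ae_height_growth R phi phi_norm phi_strict d Omega P U f X
    (ratr z1, ratr z2) (ratr rho) A%:R c M X_poisson rho0 (ler0n _ _) discU c0.
  have cfM x : disc (ratr z1, ratr z2) (3 * ratr rho) x -> c <= f x <= M.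
    by move=> dx; rewrite cf//= (le_trans (ler_norm _))// hM//; exact: discU.
  by move=> /(_ cfM); apply: filterS => w hw _.
apply: filterS growth_ae => w hw K cK KU.
have {}hw (z1 z2 rho : rat) A : growth (ratr z1, ratr z2) (ratr rho) A w.
  by have := hw (pickle (z1, z2, rho, A)); rewrite pickleK.
apply/cvgeyPge => A.
pose B := Num.truncn `|A|; have AB : A <= B.+1%:R.
  by rewrite (le_trans (ler_norm _))// ltW// truncnS_gt.
have covK : \forall n \near \oo, K `<=`
    [set x | ((B.+1%:R * Num.sqrt n%:R)%:E <= pareto_height phi (X n w) x)%E].
  (* Each point of [K] has a neighbourhood with its own threshold on [n]; compactness makes the
     threshold uniform on [K]. *)
  move/compact_near_coveringP : cK; apply => x Kx.
  have Ux := KU x Kx; have fx0 := f_pos x Ux.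
  (* Continuity and positivity of [f] at [x] provide the lower bound [f x / 2] that makes a small
     disc [good]. *)
  have : nbhs x (U `&` [set y | f x / 2 < f y]).
    apply: filterI; first exact: open_nbhs_nbhs.
    have fgt : nbhs (f x) [set t | f x / 2 < t] by apply: lt_nbhsr; lra.
    exact: (fU x Ux _ fgt).
  move=> /rational_disc[z1 [z2 [rho [rho0 dx sub]]]].
  have gz : good (ratr z1, ratr z2) (ratr rho).
    split=> //; split; first by move=> y /sub[].
    by exists (f x / 2) => [|y /sub[_ /ltW//]]; lra.
  have hn := hw z1 z2 rho B.+1 gz.
  exists (disc (ratr z1, ratr z2) (ratr rho / 2),
    [set n | forall x, disc (ratr z1, ratr z2) (ratr rho / 2) x ->
      ((B.+1%:R * Num.sqrt n%:R)%:E <= pareto_height phi (X n w) x)%E]).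
    by split=> //=; apply: open_nbhs_nbhs; split => //; exact: open_disc.
  by move=> [y n] /= [dy hyn]; exact: hyn.
near=> n.
have n0 : (0 < n)%N by near: n; exact: nbhs_infty_gt.
have sn : 0 < Num.sqrt n%:R :> R by rewrite sqrtr_gt0 ltr0n.
apply/ereal_infP => _ [x Kx <-].
have Khn : K `<=` [set x | ((B.+1%:R * Num.sqrt n%:R)%:E <=
   pareto_height phi (X n w) x)%E] by near: n.
have si0 : (0 <= ((Num.sqrt n%:R)^-1)%:E :> \bar R)%E by [].
apply: le_trans (lee_wpmul2l si0 (Khn x Kx)).
by rewrite -EFinM lee_fin mulrC mulfK// gt_eqF.
Unshelve. all: by end_near. Qed.
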